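(* For every integer $r\geq 2$ there is a bijection $\Phi:\mathcal{P}_r\to\mathcal{A}_r$ which preserves weight and length, i.e. for every $(\mu,\lambda)\in\mathcal{P}_r$ the partition $\Phi(\mu,\lambda)$ has weight $|(\mu,\lambda)|$ and has the same length as $(\mu,\lambda)$.
   Context: Here a partition is a finite non-increasing sequence of non-negative integers (zero parts allowed); it is equivalently described by its multiplicity sequence $(f_u)_{u\geq 0}$, where $f_u$ is the number of parts equal to $u$ (finitely many $f_u$ are positive). Its weight is $\sum_{u\geq0} u f_u$ and its length is $\sum_{u\geq 0} f_u$ (the number of parts, zeros included). $\mathcal{A}_r$ is the set of partitions $(f_u)_{u\geq 0}$ with $f_0\leq r-1$ and $f_u+f_{u+1}\leq r-1$ for all $u\geq 0$. For integers $s_1\geq s_2\geq\cdots\geq s_{r-1}\geq 0$, set $s_0=\infty$, $s_r=0$, and let $\mu(s_1,\ldots,s_{r-1})$ be the partition with multiplicity sequence given by $(f_{2u},f_{2u+1})=(j,0)$ for all $j\in\{0,\ldots,r-1\}$ and all $u$ with $s_{j+1}\leq u<s_j$. Let $\mathcal{P}(s_1,\ldots,s_{r-1})$ be the set of sequences $\lambda=(\lambda_0,\ldots,\lambda_{s_1-1})$ of non-negative integers such that for each $j\in\{1,\ldots,r-1\}$ one has $\lambda_{s_{j+1}}\leq\lambda_{s_{j+1}+1}\leq\cdots\leq\lambda_{s_j-1}$. Let $\mathcal{P}_r=\bigsqcup_{s_1\geq\cdots\geq s_{r-1}\geq0}\{\mu(s_1,\ldots,s_{r-1})\}\times\mathcal{P}(s_1,\ldots,s_{r-1})$.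 The weight of $(\mu(s_1,\ldots,s_{r-1}),\lambda)\in\mathcal{P}_r$ is $|\mu(s_1,\ldots,s_{r-1})|+\lambda_0+\cdots+\lambda_{s_1-1}$ (where $|\mu|$ is the weight of the partition $\mu$), and its length is the length of $\mu(s_1,\ldots,s_{r-1})$, namely $s_1+\cdots+s_{r-1}$. *)

(* Defs.v *)
From mathcomp Require Import all_boot finmap.
From mathcomp Require Import mathcomp_extra boolp classical_sets functions.

Set Implicit Arguments.
Unset Strict Implicit.
Unset Printing Implicit Defensive.

Local Open Scope classical_set_scope.
Local Open Scope nat_scope.

(* A partition with zero parts allowed, as its multiplicity sequence
   (f_u)_{u >= 0}: a finitely supported function, f u being the number of
   parts equal to u. *)
Definition mpart := {fsfun nat -> nat with 0}.

Definition mpart_weight (f : mpart) : nat := \sum_(u <- finsupp f) u * f u.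

Definition mpart_length (f : mpart) : nat := \sum_(u <- finsupp f) f u.

Definition calA (r : nat) : set mpart :=
  [set f : mpart | f 0 <= r - 1 /\ forall u, f u + f u.+1 <= r - 1].

(* Integers s_1 >= ... >= s_{r-1} >= 0 are given by a non-increasing tuple of
   size r - 1. [part_s s j] is s_j for j >= 1, with s_r = 0 as the default
   value of [nth]; its value at j = 0 is irrelevant. *)
Definition part_s (s : seq nat) (j : nat) : nat := nth 0 s j.-1.

(* s_{j+1} <= u < s_j, where s_0 is infinite *)
Definition in_block (s : seq nat) (j u : nat) : bool :=
  (part_s s j.+1 <= u) && ((j == 0) || (u < part_s s j)).

(* The least j >= 0 such that s_{j+1} <= u. For s non-increasing it is the only
   j such that s_{j+1} <= u < s_j: see [block_indexP]. *)
Definition block_index (s : seq nat) (u : nat) : nat := find (geq u) s.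

Definition mu (s : seq nat) : mpart :=
  [fsfun v in [fset w in iota 0 (2 * part_s s 1)]%fset =>
     if odd v then 0 else block_index s v./2].

Lemma geq_nth (s : seq nat) (i k : nat) :
  sorted geq s -> i <= k -> nth 0 s k <= nth 0 s i.
Proof.
move=> ss ik; case: (ltnP k (size s)) => [ks|/(nth_default 0)-> //].
have geqT : transitive geq by move=> y x z /= yx zy; exact: leq_trans zy yx.
by apply: (sorted_leq_nth geqT leqnn 0 ss) => //; apply: leq_ltn_trans ik ks.
Qed.

Lemma in_block_index (s : seq nat) (u : nat) : in_block s (block_index s u) u.
Proof.
rewrite /in_block /part_s /=; apply/andP; split.
  have [hs|/hasNfind e] := boolP (has (geq u) s); first exact: (nth_find 0 hs).
  by rewrite /block_index e nth_default.
case E: (block_index s u) => [//|i] /=.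
have : i < find (geq u) s by rewrite -/(block_index s u) E.
by move=> /(before_find 0) /= /negbT; rewrite -ltnNge.
Qed.

Lemma in_block_uniq (s : seq nat) (i j u : nat) :
  sorted geq s -> in_block s i u -> in_block s j u -> i = j.
Proof.
move=> ss; wlog ij : i j / i < j => [wl bi bj|].
  by have [ij|ji|//] := ltngtP i j; [|apply/esym]; apply: wl.
rewrite /in_block /part_s; case: j ij => // j; rewrite ltnS /= => ij.
move=> /andP[iu _] /andP[_ uj].
by have := leq_trans uj (leq_trans (geq_nth ss ij) iu); rewrite ltnn.
Qed.

Lemma block_indexP (s : seq nat) (j u : nat) :
  sorted geq s -> in_block s j u -> block_index s u = j.
Proof. by move=> ss; apply: in_block_uniq ss (in_block_index s u). Qed.

(* The defining property of mu(s_1, ..., s_{r-1}). *)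
Lemma mu_block (s : seq nat) (j u : nat) :
  sorted geq s -> in_block s j u ->
  (mu s (2 * u), mu s (2 * u + 1)) = (j, 0).
Proof.
move=> ss bj; rewrite /mu !fsfun_fun !inE !mem_iota /= add0n !mul2n.
rewrite addn1 /= odd_double /= if_same doubleK ltn_double (block_indexP ss bj).
case: ltnP => // le1; congr pair.
apply: (in_block_uniq ss _ bj).
by rewrite /in_block /part_s eqxx andbT.
Qed.

(* Hence the union in [calP] below is disjoint. *)
Lemma mu_inj (r : nat) (s t : (r - 1).-tuple nat) :
  sorted geq s -> sorted geq t -> mu s = mu t -> s = t.
Proof.
have nthE (s' : seq nat) u j : sorted geq s' ->
    (u < nth 0 s' j) = (j < mu s' (2 * u)).
  move=> ss; have hb := in_block_index s' u.
  have [-> _] := mu_block ss hb.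
  move: hb; rewrite /in_block /part_s /=; set b := block_index _ _.
  move=> /andP[h1 h2]; apply/idP/idP => [uj|].
    rewrite ltnNge; apply/negP => bj.
    by have := leq_trans uj (leq_trans (geq_nth ss bj) h1); rewrite ltnn.
  case: b h2 {h1} => // b /= ub; rewrite ltnS => jb.
  exact: leq_trans ub (geq_nth ss jb).
move=> ss st e; apply/val_inj/(@eq_from_nth _ 0) => [|j _].
  by rewrite !size_tuple.
apply/eqP; rewrite eqn_leq; apply/andP; split.
  by rewrite leqNgt (nthE _ _ _ ss) e -(nthE _ _ _ st) ltnn.
by rewrite leqNgt (nthE _ _ _ st) -e -(nthE _ _ _ ss) ltnn.
Qed.

Definition calPs (r : nat) (s : (r - 1).-tuple nat) : set (seq nat) :=
  [set l : seq nat | size l = part_s s 1 /\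
     forall j, 1 <= j <= r - 1 ->
     forall i, part_s s j.+1 <= i -> i.+1 < part_s s j ->
       nth 0 l i <= nth 0 l i.+1].

Definition calP (r : nat) : set (mpart * seq nat) :=
  \bigcup_(s in [set s : (r - 1).-tuple nat | sorted geq s])
    ([set mu s] `*` calPs s).

Definition calP_weight (x : mpart * seq nat) : nat :=
  mpart_weight x.1 + sumn x.2.

Definition calP_length (x : mpart * seq nat) : nat := mpart_length x.1.

(* Main.v *)
Require Import Defs.
From HB Require Import structures.
From mathcomp Require Import all_boot finmap ssralg zify.
From mathcomp Require Import mathcomp_extra boolp classical_sets functions.

Set Implicit Arguments.
Unset Strict Implicit.
Unset Printing Implicit Defensive.

Import GRing.Theory.

Local Open Scope classical_set_scope.
Local Open Scope nat_scope.

(* Both sides are enumerated by weight, length and a third statistic n, and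
   the counts are compared as power series in q and z; put K = r - 1.

   On the side of P_r, n is s_1.  Removing s_1 and the last block of lambda
   gives a recursion with the factor z^n q^(n(n-1)) / (q)_(n-m), where m = s_2.

   On the side of A_r, mark in each maximal run of nonzero multiplicities every
   other position, starting from the right; n is the number of marks.  Moving
   one part down at every marked position decreases the weight by n, except
   that a part moved down from 0 is deleted.  This is reversed by moving parts
   up at positions marked from the left, so it gives a recursion on weight and
   length for the partitions with f_0 <= i (series [aser]) and for those with
   f_0 < i, where a mark at 0 is not counted (series [cser]).  The series that
   satisfy the first kind of recursion, on K, also satisfy the second kind, on
   i: this is [aser_rec], proved together with [cser_conv] by induction on
   K. *)

(** * Bivariate power series and monomial factors *)

(* [a w l] is the coefficient of q^w z^l; [shift d e] is multiplication by
   q^d z^e. *)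
Notation series := (nat -> nat -> nat).

Definition shift (d e : nat) (a : series) : series :=
  fun w l => if (d <= w) && (e <= l) then a (w - d) (l - e) else 0.

Definition one_series : series := fun w l => (w == 0) && (l == 0).

Lemma shift0 (a : series) : shift 0 0 a = a.
Proof. by apply/funext => w; apply/funext => l; rewrite /shift !subn0. Qed.

Lemma shift_shift (d e d' e' : nat) (a : series) :
  shift d e (shift d' e' a) = shift (d + d') (e + e') a.
Proof.
apply/funext => w; apply/funext => l; rewrite /shift !subnDA.
have -> : (d + d' <= w) = (d <= w) && (d' <= w - d) by lia.
have -> : (e + e' <= l) = (e <= l) && (e' <= l - e) by lia.
by case: (d <= w); case: (e <= l); case: (_ <= _); case: (_ <= _).
Qed.

Lemma seriesD (a b : series) (w l : nat) : (a + b)%R w l = a w l + b w l.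
Proof. by []. Qed.

Lemma series0 (w l : nat) : (0%R : series) w l = 0.
Proof. by []. Qed.

Lemma shift_nmod (d e : nat) : nmod_morphism (shift d e).
Proof.
split=> [|a b]; apply/funext => w; apply/funext => l.
  by rewrite /shift !series0; case: ifP.
by rewrite seriesD /shift seriesD; case: ifP.
Qed.

HB.instance Definition _ (d e : nat) :=
  GRing.isNmodMorphism.Build series series (shift d e) (shift_nmod d e).

(** * Division by (1 - q) ... (1 - q^k) *)

(** At weight w, [shift d.+1 0 x] only involves x at lower weights. Coefficients in nat do not
    contain 1 - q^(d+1), so quotients are identified by this equation instead. *)
Lemma shift_fixpoint_uniq (d : nat) (b x y : series) :
  (x = b + shift d.+1 0 x)%R -> (y = b + shift d.+1 0 y)%R -> x = y.
Proof.
move=> ex ey; apply/funext => w; apply/funext => l.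
elim/ltn_ind: w => w IH; rewrite ex ey !seriesD /shift.
case: ifP => // /andP[dw _].
by rewrite subn0 IH //; lia.
Qed.

(* [geom k] is multiplication by 1/((1 - q) ... (1 - q^k)). *)
Fixpoint geom (k : nat) (a : series) : series :=
  if k is k'.+1 then
    fun w l => \sum_(j < w.+1) iter j (shift k 0) (geom k' a) w l
  else a.

Lemma geomS (k : nat) (a : series) :
  geom k.+1 a = (geom k a + shift k.+1 0 (geom k.+1 a))%R.
Proof.
(* Iterates with j > w vanish at weight w, so the truncation in [geom] loses nothing. *)
have z (b : series) j w l : w < j -> iter j (shift k.+1 0) b w l = 0.
  elim: j w => // j IH w wj /=; rewrite /shift; case: ifP => // /andP[kw _].
  by rewrite subn0; apply: IH; lia.
have widen (b : series) w l N : w < N ->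
    \sum_(j < N) iter j (shift k.+1 0) b w l
    = \sum_(j < w.+1) iter j (shift k.+1 0) b w l.
  move=> wN; rewrite -(subnKC wN) big_split_ord /= [X in _ + X]big1 ?addn0 //.
  by move=> j _; apply: (z b (w.+1 + j)); lia.
apply/funext => w; apply/funext => l; rewrite seriesD [LHS]/= big_ord_recl.
congr addn; rewrite /shift /=; case: ifP => [/andP[kw _]|h].
  rewrite -[RHS](@widen _ _ _ w); last by lia.
  by apply: eq_bigr => j _; rewrite add0n.
by rewrite big1.
Qed.

Lemma geom_nmod (k : nat) : nmod_morphism (geom k).
Proof.
elim: k => // k [IH0 IHD]; split=> [|a b].
  apply: (shift_fixpoint_uniq (geomS k 0%R)).
  by rewrite IH0 raddf0 addr0.
apply: (shift_fixpoint_uniq (geomS k (a + b)%R)).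
by rewrite {1}geomS [X in (_ + X)%R]geomS IHD raddfD addrACA.
Qed.

HB.instance Definition _ (k : nat) :=
  GRing.isNmodMorphism.Build series series (geom k) (geom_nmod k).

Lemma geom_shift (k d e : nat) (a : series) :
  geom k (shift d e a) = shift d e (geom k a).
Proof.
elim: k => // k IH; apply: (shift_fixpoint_uniq (geomS k (shift d e a))).
by rewrite {1}geomS raddfD IH /= !shift_shift addnC [e + 0]addnC.
Qed.

(** * Convolution with 1/(q)_k *)

Definition geom_conv (g : nat -> series) (n : nat) : series :=
  (\sum_(m < n.+1) geom (n - m) (g m))%R.

Lemma geom_conv0 (g : nat -> series) : geom_conv g 0 = g 0.
Proof. by rewrite /geom_conv big_ord1. Qed.

Lemma geom_convD (g h : nat -> series) (n : nat) :
  geom_conv (fun m => (g m + h m)%R) n = (geom_conv g n + geom_conv h n)%R.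
Proof.
by rewrite -big_split; apply: eq_bigr => m _; rewrite raddfD.
Qed.

Lemma geom_convS0 (g : nat -> series) (n : nat) :
  g 0 = 0%R -> geom_conv g n.+1 = geom_conv (g \o S) n.
Proof. by move=> g0; rewrite /geom_conv big_ord_recl g0 raddf0 add0r. Qed.

Lemma geom_conv_shift (d e : nat) (g : nat -> series) (n : nat) :
  geom_conv (fun m => shift d e (g m)) n = shift d e (geom_conv g n).
Proof. by rewrite raddf_sum; apply: eq_bigr => m _; rewrite geom_shift. Qed.

(* Each coefficient satisfies q^m / (q)_(n+1-m)
   = q^(n+1) / (q)_(n+1-m) + q^m / (q)_(n-m). *)
Lemma geom_conv_qpow (g : nat -> series) (n : nat) :
  geom_conv (fun m => shift m 0 (g m)) n.+1
  = (shift n.+1 0 (geom_conv g n.+1)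
     + geom_conv (fun m => shift m 0 (g m)) n)%R.
Proof.
rewrite /geom_conv [in LHS]big_ord_recr [in X in (X + _)%R]big_ord_recr /=.
rewrite raddfD /= subnn addrAC; congr (_ + _)%R.
rewrite raddf_sum -big_split; apply: eq_bigr => -[m /= mn] _.
rewrite subSn // [in LHS]geomS (geom_shift (n - m).+1) shift_shift addrC.
by have -> : (n - m).+1 + m = n.+1 by lia.
Qed.

(** The hypotheses have the shape of [aser_rec] at one K. The part of [a] with [a'] goes through
    [geom_conv_qpow]; the part with [c] is only reindexed. *)
Lemma geom_conv_recS (a a' c : nat -> series) (n : nat) :
  a 0 = a' 0 ->
  (forall m, a m.+1 = (shift m.+1 0 (a' m.+1) + shift m 1 (c m))%R) ->
  geom_conv a n.+1 = (shift n.+1 0 (geom_conv a' n.+1)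
    + geom_conv (fun m => (shift m 0 (a' m) + shift m 1 (c m))%R) n)%R.
Proof.
move=> a0 aS.
pose d m := (if m is m'.+1 then shift m' 1 (c m') else 0)%R.
have -> : a = (fun m => (shift m 0 (a' m) + d m)%R).
  by apply/funext => -[|m]; rewrite ?aS //= shift0 addr0.
rewrite geom_convD geom_conv_qpow [geom_conv d _]geom_convS0 //.
by rewrite geom_convD addrA.
Qed.

(** For n > 0, [geom_conv_qpow] applied to both a' and c gives the terms of [geom_conv_recS] and one
    more, z q^n times the convolution of c. *)
Lemma geom_conv_rec (a a' c : nat -> series) (n : nat) :
  a 0 = a' 0 ->
  (forall m, a m.+1 = (shift m.+1 0 (a' m.+1) + shift m 1 (c m))%R) ->
  geom_conv (fun m => (shift m 0 (a' m) + shift m 1 (c m))%R) n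
  = (geom_conv a n + shift n 1 (geom_conv c n))%R.
Proof.
move=> a0 aS; case: n => [|n]; first by rewrite !geom_conv0 a0 shift0.
rewrite (geom_conv_recS _ a0 aS) !geom_convD geom_conv_qpow -!addrA.
congr (_ + (_ + _))%R.
have -> : (fun m => shift m 1 (c m)) = (fun m => shift 0 1 (shift m 0 (c m))).
  by apply/funext => m; rewrite shift_shift.
rewrite !geom_conv_shift geom_conv_qpow raddfD /= shift_shift.
by rewrite addn0 addrC.
Qed.

(** * Andrews-Gordon sums and their recursions *)

(** For K > 0 and i <= K this is the Andrews-Gordon sum with N_1 = n fixed: the sum over N_2 >= ...
    >= N_K of q^(N_1^2 + ... + N_K^2 - N_1 - ... - N_i) z^(N_1 + ... + N_K) / ((q)_(N_1-N_2) ...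
    (q)_(N_K)). *)
Fixpoint aser (K i n : nat) : series :=
  if K is K'.+1 then
    let step i' := shift (n * n.-1) n (geom_conv (aser K' i') n) in
    if i is i'.+1 then step i' else shift n 0 (step 0)
  else if n == 0 then one_series else 0%R.

Fixpoint cser (K i n : nat) : series :=
  if i is i'.+1 then
    (shift n 0 (aser K i n) + shift n 1 (cser K i' n))%R
  else 0%R.

Lemma aser0 (K i : nat) : aser K i 0 = one_series.
Proof.
by elim: K i => // K IH [|i] /=; rewrite ?shift0 geom_conv0 IH.
Qed.

(** The recursion at i = K reaches i = K + 1, where the bound on f_0 says no more than f_0 <= K. *)
Lemma aser_oversize (K n : nat) : aser K K.+1 n = aser K K n.
Proof.
elim: K n => // K IH n /=; congr (shift _ _ (geom_conv _ _)).
exact/funext.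
Qed.

(** The premise is [aser_rec] for K. Both summands of [cser] carry q^(n^2) z^n, since n + n(n-1) =
    n^2, and [geom_conv_rec] merges them. *)
Lemma cser_conv (K : nat) :
  (forall i n, i <= K ->
    aser K i n.+1 = (shift n.+1 0 (aser K i.+1 n.+1)
                     + shift n 1 (cser K i n))%R) ->
  forall i n, i <= K.+1 ->
    cser K.+1 i n = shift (n * n) n (geom_conv (cser K i) n).
Proof.
move=> aserE; elim=> [|i IH] n iK.
  by rewrite /geom_conv big1 ?raddf0 // => m _; rewrite raddf0.
rewrite /= -/(cser K.+1 i n) IH; last by lia.
rewrite (@geom_conv_rec (aser K i)) ?aser0 //; last first.
  by move=> m; apply: aserE; lia.
rewrite raddfD /= !shift_shift.
by congr (shift _ _ _ + shift _ _ _)%R; case: n; lia.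
Qed.

Lemma aser_rec (K i n : nat) : i <= K ->
  aser K i n.+1 = (shift n.+1 0 (aser K i.+1 n.+1)
                   + shift n 1 (cser K i n))%R.
Proof.
(* For i = 0 the [cser] term vanishes and the claim is the definition of [aser]. *)
elim: K i n => [|K IH] [|i] n iK //; rewrite ?raddf0 ?addr0 //.
rewrite (cser_conv IH) //.
rewrite [LHS]/= (@geom_conv_recS _ (aser K i.+1) (cser K i)) ?aser0 //.
  rewrite raddfD /= !shift_shift.
  (* The prefactors agree because n + n^2 = (n + 1)n. *)
  by congr (shift _ _ _ + shift _ _ _)%R; rewrite ?add0n; lia.
by move=> m; apply: IH; lia.
Qed.

(** * Counting by lists, and bijections from equal counts *)

Definition has_size (T : eqType) (A : set T) (c : nat) : Prop :=
  exists s : seq T, [/\ uniq s, size s = c & forall x, x \in s <-> A x].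

Lemma has_size0 (T : eqType) (A : set T) : (forall x, ~ A x) -> has_size A 0.
Proof. by move=> A0; exists [::]; split=> // x; split=> // /A0. Qed.

Lemma has_size1 (T : eqType) (x : T) : has_size [set x] 1.
Proof.
exists [:: x]; split=> // y; rewrite inE.
by split=> [/eqP//|->].
Qed.

Lemma has_size_image (T U : eqType) (f : T -> U) (A : set T) (c : nat) :
  {in A &, injective f} -> has_size A c -> has_size (f @` A) c.
Proof.
move=> fI [s [us <- sA]]; exists (map f s); split; last 1 first.
- move=> y; split=> [/mapP[x /sA Ax ->]|[x /sA xs <-]]; first by exists x.
  exact: map_f.
- rewrite map_inj_in_uniq // => x y /sA Ax /sA Ay.
  by apply: fI; rewrite inE.
- by rewrite size_map.
Qed.

Lemma has_sizeU (T : eqType) (A B : set T) (a b : nat) :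
  (forall x, A x -> ~ B x) -> has_size A a -> has_size B b ->
  has_size (A `|` B) (a + b).
Proof.
move=> AB [s [us <- sA]] [t [ut <- tB]]; exists (s ++ t); split.
- rewrite cat_uniq us ut andbT /=; apply/hasPn => x /tB Bx.
  by apply/negP => /sA /AB.
- by rewrite size_cat.
- move=> x; rewrite mem_cat; split=> [/orP[/sA|/tB]|[/sA->|/tB->]] //.
  + by left.
  + by right.
  + by rewrite orbT.
Qed.

(** The fibres of the two statistics are listed with equal lengths; [Phi] sends an element to the
    one with the same index in the other list. *)
Lemma stat_bij (T U : eqType) (S : Type) (y0 : U) (A : set T) (B : set U)
    (sA : T -> S) (sB : U -> S) :
  (forall s, exists c, has_size [set x | A x /\ sA x = s] c /\
                       has_size [set y | B y /\ sB y = s] c) ->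
  exists Phi : T -> U, set_bij A B Phi /\
    forall x, A x -> sB (Phi x) = sA x.
Proof.
move=> AB.
have /choice[F FP] s : exists p : seq T * seq U,
    [/\ uniq p.1, uniq p.2, size p.1 = size p.2,
        forall x, x \in p.1 <-> A x /\ sA x = s &
        forall y, y \in p.2 <-> B y /\ sB y = s].
  have [c [[p [up szp pA]] [p' [up' szp' pB]]]] := AB s.
  by exists (p, p'); split=> //=; rewrite szp szp'.
pose Phi x := nth y0 (F (sA x)).2 (index x (F (sA x)).1).
have PhiB x : A x -> B (Phi x) /\ sB (Phi x) = sA x.
  have [_ _ sz mA mB] := FP (sA x).
  by move=> Ax; apply/mB/mem_nth; rewrite -sz index_mem; apply/mA.
exists Phi; split=> [|x /PhiB[]//]; split.
- by move=> x /PhiB[].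
- move=> x y; rewrite !inE => Ax Ay e.
  have sxy : sA x = sA y by rewrite -(PhiB _ Ax).2 e (PhiB _ Ay).2.
  move: e; rewrite /Phi -sxy; have [_ ut sz mA _] := FP (sA x).
  have xs : x \in (F (sA x)).1 by apply/mA.
  have ys : y \in (F (sA x)).1 by apply/mA.
  move/eqP; rewrite nth_uniq -?sz ?index_mem // => /eqP e.
  by rewrite -(nth_index x xs) e nth_index.
- move=> y By; have [us _ sz mA mB] := FP (sB y).
  have yt : y \in (F (sB y)).2 by apply/mB.
  (* A default element of T is taken from this list, nonempty since it is as long as the list
     containing y. *)
  case E : (F (sB y)).1 => [|x0 s0]; first by rewrite -index_mem -sz E in yt.
  set i := index y (F (sB y)).2.
  have ltis : i < size (F (sB y)).1 by rewrite sz index_mem.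
  have /mA[Ax sx] := mem_nth x0 ltis.
  exists (nth x0 (F (sB y)).1 i) => //.
  by rewrite /Phi sx index_uniq // nth_index.
Qed.

(** * Counts refined by weight and length *)

Section Fiber.

Variables (T : eqType) (wt ln : T -> nat).

Definition fiber (A : set T) (w l : nat) : set T :=
  [set x | [/\ A x, wt x = w & ln x = l]].

Lemma fiberU (A B : set T) (w l : nat) :
  fiber (A `|` B) w l = fiber A w l `|` fiber B w l.
Proof.
apply/seteqP; split=> x /=; first by move=> [[Ax|Bx] ew el]; [left|right].
by move=> [[Ax ew el]|[Bx ew el]]; split=> //; [left|right].
Qed.

Lemma has_size_fiberU (A B : set T) (w l a b : nat) :
  (forall x, A x -> ~ B x) ->
  has_size (fiber A w l) a -> has_size (fiber B w l) b ->
  has_size (fiber (A `|` B) w l) (a + b).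
Proof.
by move=> AB; rewrite fiberU; apply: has_sizeU => x [/AB nB _ _] [].
Qed.

Lemma has_size_fiber_bigcup (A : nat -> set T) (w l N : nat) (c : nat -> nat) :
  (forall i j x, A i x -> A j x -> i = j) ->
  (forall i, i < N -> has_size (fiber (A i) w l) (c i)) ->
  has_size (fiber [set x | exists2 i, i < N & A i x] w l) (\sum_(i < N) c i).
Proof.
move=> Ad; elim: N => [|N IH] Ac.
  by rewrite big_ord0; apply: has_size0 => x [[]].
have -> : [set x | exists2 i, i < N.+1 & A i x]
          = [set x | exists2 i, i < N & A i x] `|` A N.
  apply/seteqP; split=> x /=.
    move=> [i]; rewrite ltnS leq_eqVlt => /predU1P[->|].
      by right.
    by move=> iN Ax; left; exists i.
  by move=> [[i iN Ax]|Ax]; [exists i => //; apply: ltnW|exists N].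
rewrite big_ord_recr; apply: has_size_fiberU => [x [i iN Ai] AN||].
- by move: iN; rewrite (Ad _ _ _ Ai AN) ltnn.
- by apply: IH => i iN; apply: Ac; lia.
- exact: Ac.
Qed.

End Fiber.

(** The count is assumed only for d <= w and e <= l, so that an induction on the degrees can provide
    it. *)
Lemma has_size_fiber_shift (T U : eqType) (wt ln : T -> nat)
    (wt' ln' : U -> nat)
    (f : T -> U) (A : set T) (d e w l : nat) (a : series) :
  {in A &, injective f} ->
  (forall x, A x -> wt' (f x) = d + wt x /\ ln' (f x) = e + ln x) ->
  (d <= w -> e <= l ->
    has_size (fiber wt ln A (w - d) (l - e)) (a (w - d) (l - e))) ->
  has_size (fiber wt' ln' (f @` A) w l) (shift d e a w l).
Proof.
move=> fI fE Aa; rewrite /shift; case: ifP => [/andP[dw el]|h]; last first.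
  apply: has_size0 => _ [[x /fE[wE lE] <-]]; rewrite wE lE => *.
  by move/negP: h; apply; lia.
suff -> : fiber wt' ln' (f @` A) w l = f @` fiber wt ln A (w - d) (l - e).
  apply: has_size_image (Aa dw el) => x y; rewrite !inE => -[Ax _ _] [Ay _ _].
  by apply: fI; rewrite inE.
apply/seteqP; split=> [_ [[x Ax <-]]|_ [x [Ax ew' el'] <-]] /=.
  have [wE lE] := fE _ Ax; rewrite wE lE => ew' el'.
  by exists x => //; split=> //; lia.
by have [wE lE] := fE _ Ax; split; [exists x|lia|lia].
Qed.

(** * Weight and length as sums over an initial segment *)

Definition supp_bound (f : mpart) : nat := \max_(u <- finsupp f) u.+1.

Lemma supp_boundP (f : mpart) (u : nat) : supp_bound f <= u -> f u = 0.
Proof.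
move=> bu; apply/eqP; rewrite -[_ == _]negbK -mem_finsupp; apply/negP => uf.
by have := leq_trans (@leq_bigmax_seq _ _ xpredT S _ uf isT) bu; rewrite ltnn.
Qed.

Lemma sum_finsupp (f : mpart) (F : nat -> nat) (N : nat) :
  supp_bound f <= N -> (forall u, f u = 0 -> F u = 0) ->
  \sum_(u <- finsupp f) F u = \sum_(u < N) F u.
Proof.
move=> bN F0; rewrite -(big_mkord xpredT F) [RHS](bigID (mem (finsupp f))) /=.
rewrite [X in _ + X]big1 => [|u]; last by rewrite memNfinsupp => /eqP/F0.
rewrite addn0 -[RHS]big_filter; apply: perm_big; apply: uniq_perm.
    exact: fset_uniq.
    exact: filter_uniq (iota_uniq _ _).
move=> u; rewrite mem_filter mem_index_iota /=.
apply/idP/andP => [uf|[]//]; split=> //; apply: leq_trans bN.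
exact: (@leq_bigmax_seq _ _ xpredT S _ uf isT).
Qed.

Lemma weightE (f : mpart) (N : nat) :
  supp_bound f <= N -> mpart_weight f = \sum_(u < N) u * f u.
Proof.
move=> bN; apply: (@sum_finsupp f (fun u => u * f u)) => // u ->.
by rewrite muln0.
Qed.

Lemma lengthE (f : mpart) (N : nat) :
  supp_bound f <= N -> mpart_length f = \sum_(u < N) f u.
Proof. by move=> bN; apply: (@sum_finsupp f f). Qed.

Definition mk_mpart (N : nat) (g : nat -> nat) : mpart :=
  [fsfun u in [fset v in iota 0 N]%fset => g u].

Lemma mk_mpartE (N : nat) (g : nat -> nat) (u : nat) :
  (forall u, N <= u -> g u = 0) -> mk_mpart N g u = g u.
Proof.
move=> g0; rewrite fsfun_fun !inE mem_iota /= add0n.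
by case: ltnP => // /g0.
Qed.

(** * Alternating marks and the moves up and down *)

Lemma mpart_zero (f : mpart) (u : nat) : exists k, f (u + k) == 0.
Proof.
by exists (supp_bound f); apply/eqP/supp_boundP; rewrite leq_addl.
Qed.

Definition run (f : mpart) (u : nat) : nat := ex_minn (mpart_zero f u).

(* [rmark f] marks the positions of each maximal run of nonzero multiplicities
   at even distance from its rmark end. *)
Definition rmark (f : mpart) (u : nat) : bool := odd (run f u).

(** Starting one position earlier, at a nonzero multiplicity, lengthens the run by one and flips its
    parity. *)
Lemma rmarkE (f : mpart) (u : nat) : rmark f u = (0 < f u) && ~~ rmark f u.+1.
Proof.
rewrite /rmark; have [fu|fu] := posnP (f u).
  suff -> : run f u = 0 by [].
  rewrite /run; case: ex_minnP => k _ kmin; apply/eqP; rewrite -leqn0.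
  by apply: kmin; rewrite addn0 fu.
suff -> : run f u = (run f u.+1).+1 by [].
rewrite /run; case: ex_minnP => k fk kmin; case: ex_minnP => k' fk' kmin'.
apply/eqP; rewrite eqn_leq; apply/andP; split.
  by apply: kmin; rewrite addnS -addSn.
case: k fk {kmin} => [|k fk].
  by rewrite addn0 => /eqP fu0; rewrite fu0 in fu.
by rewrite ltnS; apply: kmin'; rewrite addSnnS.
Qed.

Lemma rmark_gt0 (f : mpart) (u : nat) : rmark f u -> 0 < f u.
Proof. by rewrite rmarkE => /andP[]. Qed.

(** The recursion goes down from [supp_bound f], beyond which both sides are false. *)
Lemma rmark_uniq (f : mpart) (m : nat -> bool) :
  (forall u, m u = (0 < f u) && ~~ m u.+1) -> m =1 rmark f.
Proof.
move=> mE u; have [k] := ubnP (supp_bound f - u); elim: k u => // k IH u uk.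
rewrite mE rmarkE; have [bu|ub] := leqP (supp_bound f) u.
  by rewrite supp_boundP.
by rewrite IH //; lia.
Qed.

(* Indices are shifted by one: [lmark b f u.+1] says that position u is marked.
   The flag [b] forbids marking position 0. *)
Fixpoint lmark (b : bool) (f : mpart) (u : nat) : bool :=
  if u is u'.+1 then (0 < f u') && ~~ lmark b f u' else b.

Lemma lmark_le (b : bool) (f : mpart) (u : nat) : lmark b f u.+1 <= f u.
Proof. by rewrite /=; case: (f u) => // k; case: (~~ _). Qed.

Lemma lmark_uniq (b : bool) (f : mpart) (m : nat -> bool) :
  m 0 = b -> (forall u, m u.+1 = (0 < f u) && ~~ m u) -> m =1 lmark b f.
Proof. by move=> m0 mS; elim=> // u IH; rewrite mS IH. Qed.

Lemma lmark_bound (b : bool) (f : mpart) (u : nat) :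
  supp_bound f < u -> lmark b f u = false.
Proof. by case: u => // u /supp_boundP /= ->. Qed.

(** One part moves from each marked u to u + 1. The flag [b] acts as a mark at -1 and creates a new
    part 0. *)
Definition up (b : bool) (f : mpart) : mpart :=
  mk_mpart (supp_bound f).+1 (fun u => f u + lmark b f u - lmark b f u.+1).

(** One part moves from each marked u to u - 1, and is lost if u = 0; [rmark f 0] is the flag that
    restores it. *)
Definition down (f : mpart) : mpart :=
  mk_mpart (supp_bound f) (fun u => f u + rmark f u.+1 - rmark f u).

Lemma upE (b : bool) (f : mpart) (u : nat) :
  up b f u = f u + lmark b f u - lmark b f u.+1.
Proof.
apply: mk_mpartE => v bv.
by rewrite supp_boundP 1?ltnW // (@lmark_bound _ _ v) // lmark_bound // ltnW.
Qed.

Lemma downE (f : mpart) (u : nat) :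
  down f u = f u + rmark f u.+1 - rmark f u.
Proof.
apply: mk_mpartE => v bv; rewrite rmarkE (supp_boundP (leqW bv)) supp_boundP //.
Qed.

Lemma up_lmark (b : bool) (f : mpart) (u : nat) :
  up b f u + lmark b f u.+1 = f u + lmark b f u.
Proof. by rewrite upE subnK //; have := lmark_le b f u; lia. Qed.

Lemma down_rmark (f : mpart) (u : nat) :
  down f u + rmark f u = f u + rmark f u.+1.
Proof.
rewrite downE subnK //; move: (@rmark_gt0 f u).
by case: (rmark f u) => //= /(_ isT); lia.
Qed.

(** The places where the moved parts land satisfy the recursion [rmarkE] of the new partition. *)
Lemma rmark_up (b : bool) (f : mpart) : rmark (up b f) =1 lmark b f.
Proof.
move=> u; apply/esym/rmark_uniq => {}u; have := up_lmark b f u.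
rewrite /=; case: (lmark b f u) => /=; rewrite ?andbF ?andbT; first by lia.
by case: posnP => fu; lia.
Qed.

Lemma lmark_down (f : mpart) : lmark (rmark f 0) (down f) =1 rmark f.
Proof.
move=> u; apply/esym/lmark_uniq => // {}u; have := down_rmark f u.
have := rmarkE f u.
case: (rmark f u) => /=; first by case: (rmark f u.+1); rewrite ?andbF ?andbT.
by rewrite andbT; case: (rmark f u.+1); case: posnP => //=; lia.
Qed.

Lemma upK (b : bool) : cancel (up b) down.
Proof.
move=> f; apply/fsfunP => u; have := down_rmark (up b f) u.
by rewrite !rmark_up; have := up_lmark b f u; lia.
Qed.

Lemma downK (f : mpart) : up (rmark f 0) (down f) = f.
Proof.
apply/fsfunP => u; have := up_lmark (rmark f 0) (down f) u.
by rewrite !lmark_down; have := down_rmark f u; lia.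
Qed.

Lemma supp_bound_up (b : bool) (f : mpart) :
  supp_bound (up b f) <= (supp_bound f).+1.
Proof.
apply/bigmax_leqP_seq => u; rewrite mem_finsupp ltnS => + _.
by apply: contraR; rewrite -ltnNge => bu; rewrite upE supp_boundP 1?ltnW //
  (@lmark_bound _ _ u) // sub0n.
Qed.

Lemma sum_ord_shift (N : nat) (g : nat -> nat) :
  g 0 + \sum_(u < N) g u.+1 = \sum_(u < N) g u + g N.
Proof.
elim: N => [|N IH]; first by rewrite !big_ord0 addnC.
by rewrite !big_ord_recr /= addnA IH.
Qed.

Lemma up_length (b : bool) (f : mpart) :
  mpart_length (up b f) = b + mpart_length f.
Proof.
have bN := leqnSn (supp_bound f); set N := (supp_bound f).+1 in bN.
rewrite (lengthE (supp_bound_up b f)) (lengthE bN) -/N.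
have := sum_ord_shift N (lmark b f).
rewrite (@lmark_bound b f N (leqnn _)) addn0.
have : \sum_(u < N) (up b f u + lmark b f u.+1)
       = \sum_(u < N) (f u + lmark b f u).
  by apply: eq_bigr => u _; apply: up_lmark.
by rewrite !big_split /=; lia.
Qed.

Definition marks (f : mpart) : nat := \sum_(u < supp_bound f) rmark f u.

Lemma marksE (f : mpart) (N : nat) :
  supp_bound f <= N -> marks f = \sum_(u < N) rmark f u.
Proof.
move=> bN; have m0 u : f u = 0 -> (rmark f u : nat) = 0.
  by move=> fu; rewrite rmarkE fu.
by rewrite /marks -(sum_finsupp (leqnn _) m0) (sum_finsupp bN m0).
Qed.

(** A run of length k gets ceil(k/2) marks from either end. With [b], a run starting at 0 gets only
    floor(k/2) from the left, and the deficit is [rmark f 0]. *)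
Lemma marks_lmark (b : bool) (f : mpart) (N : nat) : supp_bound f < N ->
  \sum_(u < N) lmark b f u.+1 + (b && rmark f 0) = marks f.
Proof.
move=> bN; rewrite (marksE (ltnW bN)).
have := sum_ord_shift N (fun u => lmark b f u && rmark f u : nat).
rewrite /= (@lmark_bound b f N) //=.
(* The correction terms, products of a left and a right mark, telescope. *)
have : \sum_(u < N) (lmark b f u.+1 + (lmark b f u && rmark f u))
       = \sum_(u < N) (rmark f u + (lmark b f u.+1 && rmark f u.+1)).
  apply: eq_bigr => u _; rewrite /= rmarkE.
  by case: (0 < f u); case: (lmark b f u); case: (rmark f u.+1).
by rewrite !big_split /=; lia.
Qed.

(** Each left mark raises one part by 1, and a new part 0 weighs nothing; [marks_lmark] turns left
    marks into right marks. *)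
Lemma up_weight (f : mpart) (b : bool) :
  mpart_weight (up b f) + (b && rmark f 0) = marks f + mpart_weight f.
Proof.
have bN := leqnSn (supp_bound f); set N := (supp_bound f).+1 in bN.
rewrite (weightE (supp_bound_up b f)) (weightE bN) -/N.
have := sum_ord_shift N (fun u => u * lmark b f u).
rewrite (@lmark_bound b f N (leqnn _)) muln0 mul0n add0n.
have <- := @marks_lmark b f N (leqnn _).
have : \sum_(u < N) (u * up b f u + u * lmark b f u.+1)
       = \sum_(u < N) (u * f u + u * lmark b f u).
  by apply: eq_bigr => u _; rewrite -!mulnDr up_lmark.
have : \sum_(u < N) u.+1 * lmark b f u.+1
       = \sum_(u < N) (u * lmark b f u.+1 + lmark b f u.+1).
  by apply: eq_bigr => u _; rewrite mulSn addnC.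
by rewrite !big_split /=; lia.
Qed.

Lemma up_marks (b : bool) (f : mpart) :
  marks (up b f) + (b && rmark f 0) = marks f + b.
Proof.
have bN := leqnSn (supp_bound f); set N := (supp_bound f).+1 in bN.
rewrite (marksE (supp_bound_up b f)) -/N.
have -> : \sum_(u < N) rmark (up b f) u = \sum_(u < N) lmark b f u.
  by apply: eq_bigr => u _; rewrite rmark_up.
have := sum_ord_shift N (lmark b f).
rewrite (@lmark_bound b f N (leqnn _)) addn0 [X in X + _]/=.
by have := @marks_lmark b f N (leqnn _); lia.
Qed.

(** * Generating series of the admissible partitions *)

Definition admissible (K : nat) (f : mpart) : Prop :=
  forall u, f u + f u.+1 <= K.

(** The sum at u and u + 1 can only grow if u receives a part. Then u is unmarked, so u + 1 loses a
    part unless its multiplicity is 0, and in that case f u < K suffices. *)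
Lemma up_admissible (K : nat) (b : bool) (f : mpart) :
  (b -> f 0 < K) -> admissible K f -> admissible K (up b f).
Proof.
move=> bK fK u; have := up_lmark b f u; have := up_lmark b f u.+1.
have := fK u; have := fK u.+1; rewrite [lmark b f u.+2]/= [lmark b f u.+1]/=.
(* A receiving u > 0 has a left neighbour with nonzero multiplicity. *)
have : lmark b f u -> f u < K.
  case: u => [|u] //= /andP[fu _]; have := fK u; lia.
by case: (lmark b f u) => /= [/(_ isT)|_]; case: (posnP (f u));
  case: (posnP (f u.+1)) => /=; lia.
Qed.

Lemma down_admissible (K : nat) (f : mpart) :
  admissible K f -> admissible K (down f).
Proof.
move=> fK u; have := down_rmark f u; have := down_rmark f u.+1.
have := fK u; have := fK u.+1; have := rmarkE f u; have := rmarkE f u.+1.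
have := @rmark_gt0 f u.+2.
case: (rmark f u.+2) => [/(_ isT)|_]; case: (rmark f u.+1); case: (rmark f u);
  case: (posnP (f u)); case: (posnP (f u.+1)) => //=; lia.
Qed.

Local Notation mpart_fiber := (fiber mpart_weight mpart_length).

Definition setA (K i n : nat) : set mpart :=
  [set f | [/\ admissible K f, f 0 <= i & marks f = n]].

Definition setC (K i n : nat) : set mpart :=
  [set f | [/\ admissible K f, f 0 < i & marks f = n + rmark f 0]].

Lemma up0_at0 (f : mpart) : up false f 0 = (f 0).-1.
Proof.
have := up_lmark false f 0; rewrite /= andbT addn0.
by case: (posnP (f 0)); lia.
Qed.

Lemma up1_at0 (f : mpart) : up true f 0 = (f 0).+1.
Proof. by have := up_lmark true f 0; rewrite /= andbF; lia. Qed.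

Lemma rmark_up0 (b : bool) (f : mpart) : rmark (up b f) 0 = b.
Proof. by rewrite rmark_up. Qed.

(** The preimage of f is [down f], and [rmark f 0] selects the term. The bounds on f_0 come from
    [up0_at0] and [up1_at0]. *)
Lemma setA_rec (K i n : nat) : i <= K ->
  setA K i n.+1 = up false @` setA K i.+1 n.+1 `|` up true @` setC K i n.
Proof.
move=> iK; apply/seteqP; split=> f /=.
  move=> [fK fi fn]; have := up_marks (rmark f 0) (down f).
  have := downK f; have := down_admissible fK.
  case: (rmark f 0) => gK gE; rewrite gE fn => gn.
    right; exists (down f) => //; split=> //; last by move: gn => /=; lia.
    by move: fi; rewrite -{1}gE up1_at0.
  left; exists (down f) => //; split=> //; last by move: gn => /=; lia.
  by move: fi; rewrite -{1}gE up0_at0; lia.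
move=> [[g [gK gi gn] <-]|[g [gK gi gn] <-]]; split.
- exact: up_admissible.
- by rewrite up0_at0; lia.
- by have := up_marks false g; rewrite gn /=; lia.
- by apply: up_admissible => // _; apply: leq_trans iK.
- by rewrite up1_at0.
- by have := up_marks true g; rewrite gn /=; lia.
Qed.

Lemma setC_rec (K i n : nat) : i <= K ->
  setC K i.+1 n = up false @` setA K i.+1 n `|` up true @` setC K i n.
Proof.
move=> iK; apply/seteqP; split=> f /=.
  move=> [fK fi]; have := up_marks (rmark f 0) (down f).
  have := downK f; have := down_admissible fK.
  case: (rmark f 0) => gK gE; rewrite gE => gn fn; rewrite fn in gn.
    right; exists (down f) => //; split=> //; last by move: gn => /=; lia.
    by move: fi; rewrite -{1}gE up1_at0.
  left; exists (down f) => //; split=> //; last by move: gn => /=; lia.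
  by move: fi; rewrite -{1}gE up0_at0; lia.
move=> [[g [gK gi gn] <-]|[g [gK gi gn] <-]]; split; rewrite ?rmark_up0.
- exact: up_admissible.
- by rewrite up0_at0; lia.
- by have := up_marks false g; rewrite gn /=; lia.
- by apply: up_admissible => // _; apply: leq_trans iK.
- by rewrite up1_at0.
- by have := up_marks true g; rewrite gn /=; lia.
Qed.

Lemma up_disjoint (A B : set mpart) (f : mpart) :
  (up false @` A) f -> ~ (up true @` B) f.
Proof.
move=> [g _ <-] [h _ e].
by have := rmark_up0 true h; rewrite e rmark_up0.
Qed.

(** The right end of a nonempty run is always marked. *)
Lemma marks0 (f : mpart) : marks f = 0 -> f = [fsfun].
Proof.
move=> /eqP; rewrite sum_nat_eq0 => /forallP /= f0.
have r0 u : rmark f u = false.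
  have [bu|ub] := leqP (supp_bound f) u; first by rewrite rmarkE supp_boundP.
  by have := f0 (Ordinal ub); rewrite eqb0 => /negbTE.
apply/fsfunP => u; rewrite fsfun0E.
by have := r0 u; rewrite rmarkE r0 andbT; case: (f u).
Qed.

Lemma has_size_up (b : bool) (A : set mpart) (d w l : nat) (a : series) :
  (forall f, A f -> mpart_weight (up b f) = d + mpart_weight f) ->
  (d <= w -> b <= l -> has_size (mpart_fiber A (w - d) (l - b))
    (a (w - d) (l - b))) ->
  has_size (mpart_fiber (up b @` A) w l) (shift d b a w l).
Proof.
move=> wA; apply: has_size_fiber_shift => [f g _ _|f Af].
  exact: can_inj (upK b) _ _.
by rewrite wA // up_length.
Qed.

(** Induction on w + l. Only the first term of [setC_rec] at n = 0 leaves (w, l) unchanged, so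
    [setA] is settled before [setC] at each (w, l). *)
Lemma has_size_setA_setC (K w l : nat) :
  (forall i n, i <= K.+1 ->
     has_size (mpart_fiber (setA K i n) w l) (aser K i n w l))
  /\
  (forall i n, i <= K.+1 ->
     has_size (mpart_fiber (setC K i n) w l) (cser K i n w l)).
Proof.
have [N] := ubnP (w + l); elim: N w l => // N IH w l wlN.
have Astep i n : i <= K.+1 ->
    has_size (mpart_fiber (setA K i n) w l) (aser K i n w l).
  wlog iK : i / i <= K => [wl iK1|_].
    have [/wl|Ki] := leqP i K; first exact.
    have -> : i = K.+1 by lia.
    rewrite aser_oversize; have -> : setA K K.+1 n = setA K K n.
      apply/seteqP; split=> f [fK fi fn]; split=> //; last by lia.
      by have := fK 0; lia.
    by apply: wl; lia.
  case: n => [|n].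
    rewrite aser0 /one_series.
    have -> : mpart_fiber (setA K i 0) w l
              = [set f | f = [fsfun] /\ w = 0 /\ l = 0].
      have s0 : supp_bound [fsfun] <= 0.
        by apply/bigmax_leqP_seq => u; rewrite finsupp0.
      have w0 : mpart_weight [fsfun] = 0 by rewrite (weightE s0) big_ord0.
      have l0 : mpart_length [fsfun] = 0 by rewrite (lengthE s0) big_ord0.
      apply/seteqP; split=> f /=.
        by move=> [[_ _ /marks0 ->]]; rewrite w0 l0.
      move=> [-> [-> ->]]; split=> //; split.
      - by move=> u; rewrite !fsfun0E.
      - by rewrite fsfun0E.
      - by rewrite (marksE s0) big_ord0.
    case: w {wlN} => [|w]; last by apply: has_size0 => f [_ []].
    case: l => [|l]; last by apply: has_size0 => f [_ []].
    have -> : [set f : mpart | f = [fsfun] /\ 0 = 0 /\ 0 = 0] = [set [fsfun]].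
      by apply/seteqP; split=> f //= [].
    exact: has_size1.
  rewrite setA_rec // aser_rec // seriesD.
  apply: has_size_fiberU; first by move=> f; apply: up_disjoint.
  - apply: (@has_size_up false) => [f [_ _ fn]|nw _].
      by have := up_weight f false; rewrite fn /=; lia.
    by apply: (IH _ _ _).1 => //; lia.
  - apply: (@has_size_up true) => [f [_ _ fn]|nw l1].
      by have := up_weight f true; rewrite fn /=; lia.
    by apply: (IH _ _ _).2 => //; lia.
split=> // -[|i] n iK.
  by apply: has_size0 => f [[]].
rewrite setC_rec //; apply: has_size_fiberU.
- by move=> f; apply: up_disjoint.
- apply: (@has_size_up false) => [f [_ _ fn]|nw _].
    by have := up_weight f false; rewrite fn /=; lia.
  rewrite subn0; case: n nw => [|n] nw; last by apply: (IH _ _ _).1 => //; lia.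
  by rewrite subn0; apply: Astep.
- apply: (@has_size_up true) => [f [_ _ fn]|nw l1].
    by have := up_weight f true; rewrite fn /=; lia.
  by apply: (IH _ _ _).2 => //; lia.
Qed.

(** * Sorted sequences and 1/(q)_k *)

Lemma sumn_map_succn (b : seq nat) : sumn (map succn b) = size b + sumn b.
Proof. by elim: b => //= x b ->; lia. Qed.

Definition with_block (T : Type) (A : set T) (k : nat) : set (T * seq nat) :=
  [set x | [/\ A x.1, size x.2 = k & sorted leq x.2]].

(** A first entry 0 is removed; otherwise all k + 1 entries are positive and drop by one. These are
    the two terms of [geomS]. *)
Lemma with_block_rec (T : Type) (A : set T) (k : nat) :
  with_block A k.+1 = (fun x => (x.1, 0 :: x.2)) @` with_block A k
    `|` (fun x => (x.1, map succn x.2)) @` with_block A k.+1.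
Proof.
apply/seteqP; split=> [[x b] [/= Ax]|
  _ [[[x b] [/= Ax sb ob] <-]|[[x b] [/= Ax sb ob] <-]]].
- case: b => [|[|y] b] //= [sb] ob; [left|right].
    by exists (x, b) => //; split=> //=; apply: path_sorted ob.
  exists (x, map predn (y.+1 :: b)) => /=.
    split=> //=; first by rewrite size_map sb.
    rewrite -[y]/(y.+1.-1) path_map; apply: sub_path ob => u v /=; lia.
  congr (_, _ :: _); rewrite -map_comp map_id_in // => z zb /=.
  have /allP/(_ z zb) := order_path_min leq_trans ob; lia.
- split=> //=; first by rewrite sb.
  by rewrite path_min_sorted //; apply/allP.
- split=> //=; first by rewrite size_map.
  by rewrite sorted_map.
Qed.

Section Geom.

Variables (T : eqType) (wt ln : T -> nat).

Definition block_wt (x : T * seq nat) : nat := wt x.1 + sumn x.2.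

Definition block_ln (x : T * seq nat) : nat := ln x.1.

Lemma has_size_geom (A : set T) (a : series) (k w l : nat) :
  (forall w l, has_size (fiber wt ln A w l) (a w l)) ->
  has_size (fiber block_wt block_ln (with_block A k) w l) (geom k a w l).
Proof.
move=> Aa; elim: k w l => [|k IHk] w l.
  have -> : with_block A 0 = (fun x => (x, [::])) @` A.
    apply/seteqP; split=> [[x b] [/= Ax /size0nil -> _]|_ [x Ax <-]] //=.
    by exists x.
  rewrite -[geom 0 a]shift0.
  apply: (has_size_fiber_shift (wt := wt) (ln := ln))
    => [x y _ _ []|x _|_ _] //.
  by rewrite /block_wt /= addn0.
elim/ltn_ind: w => w IHw.
rewrite with_block_rec geomS seriesD; apply: has_size_fiberU.
- by move=> _ [[x b] _ <-] [[y [|z c]] _ []].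
- rewrite -[geom k a]shift0.
  apply: (has_size_fiber_shift (wt := block_wt) (ln := block_ln)) => //.
  by move=> [x b] [y c] _ _ [-> ->].
- apply: (has_size_fiber_shift (wt := block_wt) (ln := block_ln)).
  + by move=> [x b] [y c] _ _ [-> /(inj_map succn_inj) ->].
  + move=> [x b] [/= _ sb _]; split=> //.
    by rewrite /block_wt /= sumn_map_succn sb; lia.
  + by move=> kw _; rewrite subn0; apply: IHw; lia.
Qed.

End Geom.

(** * Generating series of the pairs (s, lambda) *)

(** Here j stands for block j + 1 of [calPs]; past the end of s the default 0 makes the condition
    vacuous. *)
Definition block_sorted (s lam : seq nat) : Prop :=
  forall j i, nth 0 s j.+1 <= i -> i.+1 < nth 0 s j ->
    nth 0 lam i <= nth 0 lam i.+1.

Definition setP (K n : nat) : set (seq nat * seq nat) :=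
  [set x | [/\ size x.1 = K, sorted geq x.1, nth 0 x.1 0 = n, size x.2 = n
             & block_sorted x.1 x.2]].

(** For sorted [x.1] the first sum is the weight of [mu x.1], by [mu_weight]. *)
Definition setP_wt (x : seq nat * seq nat) : nat :=
  \sum_(u <- x.1) u * u.-1 + sumn x.2.

Definition setP_ln (x : seq nat * seq nat) : nat := sumn x.1.

Lemma setP_rec (K n : nat) :
  setP K.+1 n = (fun y => (n :: y.1.1, y.1.2 ++ y.2)) @`
    [set y | exists2 m, m < n.+1 & with_block (setP K m) (n - m) y].
Proof.
apply/seteqP; split=> [[[|k s] lam] [//= [sK] os <- slam bs]|].
  (* This is s_2, where the last block of lambda begins. *)
  set m := nth 0 s 0.
  have mn : m <= k.
    by move: os; rewrite /m; case: s {sK bs m} => //= m s /andP[].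
  exists ((s, take m lam), drop m lam); last by rewrite /= cat_take_drop.
  exists m => //; split=> /=; last 2 first.
  - by rewrite size_drop slam.
  - apply/(sortedP 0) => i; rewrite size_drop slam => im; rewrite !nth_drop.
    by rewrite addnS; apply: (bs 0) => /=; rewrite -/m; lia.
  have os' := path_sorted os.
  split=> //=; first by rewrite size_take_min slam; lia.
  move=> j i ji ij; have jm : nth 0 s j <= m by apply: geq_nth.
  by rewrite !nth_take; [exact: (bs j.+1)|lia|lia].
move=> _ [[[s lam] b] [m mn [[/= sK os sm slam bs] sb ob]] <-]; split=> //=.
- by rewrite sK.
- by move: os sm; case: s {sK bs} => //= k s -> ->; rewrite andbT.
- by rewrite size_cat slam sb; lia.
move=> [|j] i /=.
  rewrite sm => mi im; rewrite !nth_cat slam !ltnNge mi leqW //= subSn //.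
  by move/(sortedP 0): ob; apply; rewrite sb; lia.
move=> ji ij; have jm : nth 0 s j <= m by rewrite -sm; apply: geq_nth.
by rewrite !nth_cat slam !ifT; [exact: (bs j)|lia|lia].
Qed.

Lemma series_sumE (N : nat) (F : nat -> series) (w l : nat) :
  (\sum_(i < N) F i)%R w l = \sum_(i < N) F i w l.
Proof.
elim: N => [|N IH]; first by rewrite !big_ord0.
by rewrite big_ord_recr /= seriesD IH big_ord_recr.
Qed.

Lemma has_size_setP (K n w l : nat) :
  has_size (fiber setP_wt setP_ln (setP K n) w l) (aser K K n w l).
Proof.
elim: K n w l => [|K IH] n w l.
  case: n => [|n]; last by apply: has_size0 => -[s lam] [[/= /size0nil ->]].
  have -> : aser 0 0 0 = one_series by [].
  have P0 : setP 0 0 = [set ([::], [::])].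
    apply/seteqP; split=> [[s lam] [/= /size0nil -> _ _ /size0nil ->]|_ ->] //.
    by split=> // j i; rewrite !nth_nil.
  rewrite P0 /one_series.
  have wl0 : (setP_wt ([::], [::]) = 0) * (setP_ln ([::], [::]) = 0).
    by split=> //; rewrite /setP_wt big_nil.
  have -> : fiber setP_wt setP_ln [set ([::], [::])] w l
            = [set x | x = ([::], [::]) /\ w = 0 /\ l = 0].
    apply/seteqP; split=> x; first by move=> [->]; rewrite !wl0.
    by move=> [-> [-> ->]]; split; rewrite ?wl0.
  case: w => [|w]; last by apply: has_size0 => x [_ []].
  case: l => [|l]; last by apply: has_size0 => x [_ []].
  suff -> : [set x : seq nat * seq nat | x = ([::], [::]) /\ 0 = 0 /\ 0 = 0]
            = [set ([::], [::])] by exact: has_size1.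
  by apply/seteqP; split=> x //= [].
rewrite setP_rec /=.
apply: (has_size_fiber_shift (wt := block_wt setP_wt) (ln := block_ln setP_ln)).
- move=> [[s lam] b] [[s' lam'] b']; rewrite !inE.
  move=> [m _ [[/= _ _ sm slam _] _ _]] [m' _ [[/= _ _ sm' slam' _] _ _]] [es].
  (* Both prefixes have length s_2, so the concatenation splits uniquely. *)
  have elam : size lam = size lam' by rewrite slam slam' -sm -sm' es.
  by move/eqP; rewrite eqseq_cat // es => /andP[/eqP-> /eqP->].
- move=> [[s lam] b] _.
  by rewrite /block_wt /setP_wt /block_ln /setP_ln /= big_cons sumn_cat; lia.
- move=> _ _; rewrite /geom_conv.
  rewrite (series_sumE n.+1 (fun m => geom (n - m) (aser K K m))).
  apply: (has_size_fiber_bigcup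
    (c := fun m => geom (n - m) (aser K K m) (w - n * n.-1) (l - n))).
    by move=> i j x [[_ _ <- _ _] _ _] [[_ _ <- _ _] _ _].
  by move=> m _; apply: has_size_geom.
Qed.

(** * Weight and length of mu(s) *)

(** In a non-increasing list the entries above u form a prefix. As a count, the multiplicity can be
    summed in either order in [sum_mu]. *)
Lemma block_index_count (s : seq nat) (u : nat) :
  sorted geq s -> block_index s u = count (ltn u) s.
Proof.
rewrite /block_index; elim: s => //= x s IH os.
rewrite /= leqNgt; case: ltnP => [_|xu] /=.
  by rewrite IH ?(path_sorted os).
apply/esym/eqP; rewrite eqn0Ngt -has_count; apply/hasPn => y ys /=.
have geqT : transitive geq by move=> b a c /= ab bc; exact: leq_trans bc ab.
have /allP/(_ y ys) /= := order_path_min geqT os; lia.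
Qed.

Lemma sum_even_odd (N : nat) (F : nat -> nat) :
  \sum_(v < 2 * N) F v = \sum_(u < N) (F (2 * u) + F (2 * u + 1)).
Proof.
elim: N => [|N IH]; first by rewrite !big_ord0.
by rewrite mulnS add2n !big_ord_recr /= IH addnA addn1.
Qed.

Lemma mu_even (s : seq nat) (u : nat) :
  sorted geq s -> mu s (2 * u) = count (ltn u) s.
Proof.
move=> os; have [-> _] := mu_block os (in_block_index s u).
exact: block_index_count.
Qed.

Lemma mu_odd (s : seq nat) (u : nat) : sorted geq s -> mu s (2 * u + 1) = 0.
Proof. by move=> os; have [] := mu_block os (in_block_index s u). Qed.

Lemma mu_supp_bound (s : seq nat) : supp_bound (mu s) <= 2 * nth 0 s 0.
Proof.
apply/bigmax_leqP_seq => v; rewrite mem_finsupp => + _.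
rewrite /mu fsfun_fun !inE mem_iota /= add0n.
by case: ifP => //; rewrite eqxx.
Qed.

Lemma sorted_geq_head (s : seq nat) (x : nat) :
  sorted geq s -> x \in s -> x <= nth 0 s 0.
Proof. by move=> os xs; rewrite -(nth_index 0 xs); apply: geq_nth. Qed.

Lemma sum_mu (s : seq nat) (c : nat -> nat) : sorted geq s ->
  \sum_(u < nth 0 s 0) c u * count (ltn u) s = \sum_(x <- s) \sum_(u < x) c u.
Proof.
move=> os.
transitivity (\sum_(u < nth 0 s 0) \sum_(x <- s | u < x) c u).
  apply: eq_bigr => u _; rewrite -sum1_count big_distrr /=.
  by under eq_bigr do rewrite muln1.
under [LHS]eq_bigr do rewrite big_mkcond.
rewrite exchange_big; apply: eq_big_seq => x xs /=.
by rewrite -big_mkcond (big_ord_widen _ c (sorted_geq_head os xs)).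
Qed.

Lemma mu_weight (s : seq nat) : sorted geq s ->
  mpart_weight (mu s) = \sum_(u <- s) u * u.-1.
Proof.
move=> os; rewrite (weightE (mu_supp_bound s)).
rewrite (sum_even_odd _ (fun v => v * mu s v)).
under [LHS]eq_bigr => u _ do rewrite mu_even // mu_odd // muln0 addn0.
(* Each entry x contributes 2(0 + ... + (x - 1)) = x(x - 1). *)
rewrite (sum_mu (muln 2)) //; apply: eq_bigr => x _; elim: x => [|x IH].
  by rewrite big_ord0.
by rewrite big_ord_recr IH /=; case: x {IH} => //=; lia.
Qed.

Lemma mu_length (s : seq nat) : sorted geq s -> mpart_length (mu s) = sumn s.
Proof.
move=> os; rewrite (lengthE (mu_supp_bound s)) sum_even_odd.
under [LHS]eq_bigr => u _ do
  rewrite mu_even // mu_odd // addn0 -[count _ _]mul1n.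
rewrite (sum_mu (fun=> 1)) // sumnE; apply: eq_bigr => x _.
by rewrite sum1_card card_ord.
Qed.

(** * Matching the two counts *)

Lemma calP_setP (r w l n : nat) :
  [set x | calP r x /\ (calP_weight x, calP_length x, size x.2) = (w, l, n)]
  = (fun x => (mu x.1, x.2)) @` fiber setP_wt setP_ln (setP (r - 1) n) w l.
Proof.
apply/seteqP; split=> [[f lam]|].
  move=> [[s /= os [/= -> [slam bs]]] [<- <- sn]]; exists (val s, lam) => //.
  rewrite /calP_weight /calP_length /= mu_weight // mu_length //.
  split=> //; split=> //=; first exact: size_tuple.
    by rewrite -sn slam.
  move=> j i ji ij; apply: (bs j.+1) => //=.
  (* Past the end of the tuple the default 0 contradicts [ij]. *)
  rewrite ltnNge; apply/negP => rj; move: ij.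
  by rewrite [nth 0 s j]nth_default // size_tuple.
move=> _ [[s lam] [[/= sK os sn slam bs] <- <-] <-] /=.
rewrite /calP_weight /calP_length /= mu_weight // mu_length //; split=> //.
  exists (Tuple (introT eqP sK)) => //; split=> //; split=> /=.
    by rewrite slam -sn.
  by move=> [|j] // _ i; apply: bs.
by rewrite slam.
Qed.

Lemma calA_setA (r w l n : nat) :
  [set f | calA r f /\ (mpart_weight f, mpart_length f, marks f) = (w, l, n)]
  = mpart_fiber (setA (r - 1) (r - 1) n) w l.
Proof.
apply/seteqP; split=> f; first by move=> [[f0 fK] [<- <- <-]].
by move=> [[fK f0 <-] <- <-].
Qed.

Theorem mainTheorem1 (r : nat) (hr : 2 <= r) :
  exists Phi : mpart * seq nat -> mpart,
    set_bij (calP r) (calA r) Phi /\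
    forall x : mpart * seq nat, calP r x ->
      mpart_weight (Phi x) = calP_weight x /\
      mpart_length (Phi x) = calP_length x.
Proof.
have [|Phi [bij PhiE]] := @stat_bij _ _ _ (mk_mpart 0 id) (calP r) (calA r)
    (fun x => (calP_weight x, calP_length x, size x.2))
    (fun f => (mpart_weight f, mpart_length f, marks f)).
  (* The third statistic is s_1 on one side and the number of marks on the other; i = r - 1 encodes
     f_0 <= r - 1. *)
  move=> [[w l] n]; exists (aser (r - 1) (r - 1) n w l); split; last first.
    by rewrite calA_setA; apply: (has_size_setA_setC _ _ _).1.
  rewrite calP_setP; apply: has_size_image (has_size_setP _ _ _ _).
  (* Since [mu] determines s, replacing s by mu(s) keeps the count. *)
  move=> [s lam] [s' lam']; rewrite !inE.
  move=> [[/= /eqP sK os _ _ _] _ _] [[/= /eqP sK' os' _ _ _] _ _] [e ->].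
  by have /(congr1 val)/= -> := @mu_inj r (Tuple sK) (Tuple sK') os os' e.
by exists Phi; split=> // x /PhiE[-> ->].
Qed.
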